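(* Let $\beta\in[0,1)$ and let $\Gamma_\beta$ be a finite two-person non-zero-sum $\beta$-discounted stochastic game (not necessarily with transition probabilities controlled by a single player). Assume that $\Gamma_\beta$ has a completely mixed Nash equilibrium $(f^0,g^0)$. Then for all stationary strategies $f\in\mathbb{P}_1$ of player 1 and $g\in\mathbb{P}_2$ of player 2, $$I_\beta^{2}(f^0,g^0)=I_\beta^{2}(f^0,g)\qquad\text{and}\qquad I_\beta^{1}(f^0,g^0)=I_\beta^{1}(f,g^0).$$
   Context: A finite two-person stochastic game consists of a finite state space $S=\{s_1,\dots,s_K\}$, finite nonempty sets $A_1(s),A_2(s)$ of pure actions of players 1 and 2 in each state $s\in S$, real rewards $r^k(i,j,s)$ to player $k\in\{1,2\}$ when actions $i\in A_1(s)$, $j\in A_2(s)$ are chosen in state $s$, and transition probabilities $q(s'|s,i,j)$. Both players maximize their payoffs. A stationary strategy of player $k$ assigns to each $s\in S$ a probability distribution on $A_k(s)$; $\mathbb{P}_k$ is the set of stationary strategies of player $k$. It is completely mixed if in every state every pure action has strictly positive probability. For $f\in\mathbb{P}_1$, $g\in\mathbb{P}_2$, let $r_k^{(n)}(f,g,s)$ be the expected reward to player $k$ on day $n$ ($n=0,1,2,\dots$) when play starts in state $s$ and $(f,g)$ is used. The $\beta$-discounted payoff is $I_\beta^k(f,g)(s)=\sum_{n=0}^\infty\beta^n r_k^{(n)}(f,g,s)$, and $I_\beta^k(f,g)=(I_\beta^k(f,g)(s_1),\dots,I_\beta^k(f,g)(s_K))^t$. A pair $(f^0,g^0)$ of stationary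 strategies is a Nash equilibrium of $\Gamma_\beta$ if $I_\beta^1(f^0,g^0)\ge I_\beta^1(f,g^0)$ for all $f\in\mathbb{P}_1$ and $I_\beta^2(f^0,g^0)\ge I_\beta^2(f^0,g)$ for all $g\in\mathbb{P}_2$, coordinatewise. It is completely mixed if both $f^0$ and $g^0$ are completely mixed. *)

(* Defs.v *)
From HB Require Import structures.
From mathcomp Require Import all_boot all_order all_algebra.
From mathcomp Require Import all_classical all_reals all_analysis.

Set Implicit Arguments.
Unset Strict Implicit.
Unset Printing Implicit Defensive.

Import Order.TTheory GRing.Theory Num.Theory.
Import numFieldNormedType.Exports.

Local Open Scope ring_scope.

Inductive player := P1 | P2.

Record game (R : realType) := Game {
  state : finType;
  action : player -> state -> finType;
  action_nonempty : forall k s, (0 < #|action k s|)%N;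
  reward : player -> forall s : state, action P1 s -> action P2 s -> R;
  (* [trans i j s'] is q(s' | s, i, j) *)
  trans : forall s : state, action P1 s -> action P2 s -> state -> R;
  trans_ge0 : forall s (i : action P1 s) (j : action P2 s) s',
    0 <= trans i j s';
  trans_sum1 : forall s (i : action P1 s) (j : action P2 s),
    \sum_(s' : state) trans i j s' = 1
}.

Arguments action {R} g k s.
Arguments reward {R g} k {s} i j.
Arguments trans {R g s} i j s'.

Record strategy (R : realType) (G : game R) (k : player) := Strategy {
  prob :> forall s : state G, action G k s -> R;
  prob_ge0 : forall s (a : action G k s), 0 <= prob a;
  prob_sum1 : forall s, \sum_(a : action G k s) prob a = 1
}.

Arguments prob {R G k} _ s a.

Definition completely_mixed (R : realType) (G : game R) (k : player)
    (f : strategy G k) : Prop :=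
  forall (s : state G) (a : action G k s), 0 < f s a.

Section Payoff.
Variables (R : realType) (G : game R).
Variables (f : strategy G P1) (g : strategy G P2).

Definition mean_reward (k : player) (s : state G) : R :=
  \sum_(i : action G P1 s) \sum_(j : action G P2 s)
    f s i * g s j * reward k i j.

Definition mean_trans (s s' : state G) : R :=
  \sum_(i : action G P1 s) \sum_(j : action G P2 s)
    f s i * g s j * trans i j s'.

(* Probability that the state on day [n] is [s'] when play starts in [s]. *)
Fixpoint state_prob (n : nat) (s s' : state G) : R :=
  if n is m.+1 then \sum_(t : state G) state_prob m s t * mean_trans t s'
  else (s == s')%:R.

Definition day_reward (k : player) (n : nat) (s : state G) : R :=
  \sum_(s' : state G) state_prob n s s' * mean_reward k s'.

(* The series converges whenever [0 <= beta < 1],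
   since the rewards are bounded. *)
Definition payoff (beta : R) (k : player) : {ffun state G -> R} :=
  [ffun s => limn (series (fun n => beta ^+ n * day_reward k n s))].

End Payoff.

Definition nash (R : realType) (G : game R) (beta : R)
    (f0 : strategy G P1) (g0 : strategy G P2) : Prop :=
  (forall (f : strategy G P1) (s : state G),
     payoff f g0 beta P1 s <= payoff f0 g0 beta P1 s) /\
  (forall (g : strategy G P2) (s : state G),
     payoff f0 g beta P2 s <= payoff f0 g0 beta P2 s).

(* Main.v *)
Require Import Defs.
From HB Require Import structures.
From mathcomp Require Import all_boot all_order all_algebra.
From mathcomp Require Import all_classical all_reals all_analysis.
From mathcomp Require Import ring.

(** Once the opponent's stationary strategy is fixed, a player faces a
    discounted Markov decision problem.  A stationary strategy [h] has a value
    [V h] solving the linear equation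
    [V h s = \sum_a h s a * (c s a + beta * \sum_t p s a t * V h t)]
    ([payoff_recursion], [payoff_recursionP1], [payoff_recursionP2]), and any
    function that dominates its discounted mean is nonnegative
    ([discounted_ge0]).

    Let [h0] be completely mixed and optimal, and let [Q s a] be the worth of
    playing [a] on day 0 in state [s] and following [h0] afterwards.  Since
    [V h0 s] is the average of [Q s] under [h0], it is at most the maximum of
    [Q s].  The strategy that plays a maximizer of [Q s] in every state
    therefore improves on [h0] by at least [max (Q s) - V h0 s], so optimality
    of [h0] forces [max (Q s) = V h0 s].  An average with positive weights that
    equals the maximum is an average of equal numbers, whence [Q s a = V h0 s]
    for every action ([mixed_optimal_bellman]).  Averaging these equalities
    under any other strategy [h] shows that [V h0] solves the equation that
    determines [V h], and the two values agree ([mixed_optimal_indifference]).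

    At an equilibrium this applies to each player in turn. *)

Set Implicit Arguments.
Unset Strict Implicit.
Unset Printing Implicit Defensive.

Import Order.TTheory GRing.Theory Num.Theory.
Import numFieldNormedType.Exports.

Local Open Scope ring_scope.

(** * Weighted averages *)

Section Averages.
Variables (R : realType) (I : finType) (w : I -> R).
Hypotheses (w_ge0 : forall i, 0 <= w i) (w_sum1 : \sum_i w i = 1).

Lemma average_cst (m : R) : \sum_i w i * m = m.
Proof. by rewrite -mulr_suml w_sum1 mul1r. Qed.

Lemma average_ge (x : I -> R) (m : R) :
  (forall i, m <= x i) -> m <= \sum_i w i * x i.
Proof.
by move=> mx; rewrite -[leLHS]average_cst ler_sum// => i _; rewrite ler_wpM2l.
Qed.

Lemma average_le (x : I -> R) (m : R) :
  (forall i, x i <= m) -> \sum_i w i * x i <= m.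
Proof.
by move=> mx; rewrite -[leRHS]average_cst ler_sum// => i _; rewrite ler_wpM2l.
Qed.

Lemma average_normr_le (x : I -> R) (m : R) :
  (forall i, `|x i| <= m) -> `|\sum_i w i * x i| <= m.
Proof.
move=> xm; apply: le_trans (ler_norm_sum _ _ _) _.
under eq_bigr do rewrite normrM (ger0_norm (w_ge0 _)).
exact: average_le.
Qed.

Lemma average_max_cst (x : I -> R) (m : R) :
  (forall i, 0 < w i) -> (forall i, x i <= m) -> \sum_i w i * x i = m ->
  forall i, x i = m.
Proof.
move=> w_gt0 xm xE i.
have gap0 : \sum_i w i * (m - x i) = 0.
  under eq_bigr do rewrite mulrBr.
  by rewrite sumrB average_cst xE subrr.
have gap_ge0 j : true -> 0 <= w j * (m - x j).
  by move=> _; rewrite mulr_ge0// subr_ge0.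
have /eqP := psumr_eq0P gap_ge0 gap0 (i := i) isT.
by rewrite mulf_eq0 gt_eqF//= subr_eq0 => /eqP.
Qed.

End Averages.

(** * The minimum principle for discounted kernels *)

Section Discounted.
Variables (R : realType) (S : finType) (beta : R) (P : S -> S -> R).
Hypotheses (beta01 : 0 <= beta < 1) (P_ge0 : forall s t, 0 <= P s t)
  (P_sum1 : forall s, \sum_t P s t = 1).

(** At a minimizer of [D] the hypothesis gives [min D >= beta * min D]. *)
Lemma discounted_ge0 (D : S -> R) :
  (forall s, beta * \sum_t P s t * D t <= D s) -> forall s, 0 <= D s.
Proof.
case/andP: beta01 => beta_ge0 beta_lt1 D_super s.
pose m := [arg min_(t < s) D t]%O.
have m_min t : D m <= D t by rewrite /m; case: arg_minP => // u _; apply.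
apply: le_trans (m_min s).
have : beta * D m <= D m.
  apply: le_trans (D_super m); rewrite ler_wpM2l//.
  exact: average_ge.
by rewrite -subr_ge0 -{1}[D m]mul1r -mulrBl pmulr_rge0// subr_gt0.
Qed.

Lemma discounted_eq0 (D : S -> R) :
  (forall s, D s = beta * \sum_t P s t * D t) -> forall s, D s = 0.
Proof.
move=> DE s; apply/eqP; rewrite eq_le; apply/andP; split; last first.
  by apply: discounted_ge0 => t; rewrite -DE.
rewrite -oppr_ge0; apply: (discounted_ge0 (D := fun t => - D t)) => t.
under eq_bigr do rewrite mulrN.
by rewrite sumrN mulrN -DE.
Qed.

End Discounted.

(** * The payoff as solution of a linear equation *)

Section PayoffRecursion.
Local Open Scope classical_set_scope.
Local Open Scope ring_scope.
Variables (R : realType) (G : game R).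
Variables (f : strategy G P1) (g : strategy G P2).

Lemma mean_trans_ge0 s t : 0 <= mean_trans f g s t.
Proof.
by do 2!apply: sumr_ge0 => ? _; rewrite !mulr_ge0 ?prob_ge0 ?trans_ge0.
Qed.

Lemma mean_trans_sum1 s : \sum_t mean_trans f g s t = 1.
Proof.
rewrite exchange_big/= -(prob_sum1 f s); apply: eq_bigr => i _.
rewrite exchange_big/= -[RHS]mulr1 -(prob_sum1 g s) mulr_sumr.
by apply: eq_bigr => j _; rewrite -mulr_sumr trans_sum1 mulr1.
Qed.

Lemma state_prob_first_step n s s' :
  state_prob f g n.+1 s s' =
  \sum_t mean_trans f g s t * state_prob f g n t s'.
Proof.
elim: n s s' => [|n IHn] s s'.
  rewrite /= (bigD1 s)//= eqxx mul1r [in LHS]big1 => [|t ts]; last first.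
    by rewrite eq_sym (negPf ts) mul0r.
  rewrite (bigD1 s')//= eqxx mulr1 big1 => [//|t ts].
  by rewrite (negPf ts) mulr0.
rewrite [LHS]/=.
under eq_bigr do rewrite -/(state_prob f g n.+1 s _) IHn mulr_suml.
rewrite exchange_big/=; apply: eq_bigr => u _.
by rewrite mulr_sumr; apply: eq_bigr => t _; rewrite mulrA.
Qed.

Lemma day_reward0 k s : day_reward f g k 0 s = mean_reward f g k s.
Proof.
rewrite /day_reward/= (bigD1 s)//= eqxx mul1r big1 ?addr0// => t ts.
by rewrite eq_sym (negPf ts) mul0r.
Qed.

Lemma day_rewardS k n s :
  day_reward f g k n.+1 s = \sum_t mean_trans f g s t * day_reward f g k n t.
Proof.
rewrite /day_reward.
under eq_bigr do rewrite state_prob_first_step mulr_suml.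
rewrite exchange_big/=; apply: eq_bigr => u _.
by rewrite mulr_sumr; apply: eq_bigr => t _; rewrite mulrA.
Qed.

Lemma day_reward_bounded k n s :
  `|day_reward f g k n s| <= \sum_t `|mean_reward f g k t|.
Proof.
elim: n s => [|n IHn] s.
  by rewrite day_reward0 (bigD1 s)//= lerDl sumr_ge0.
rewrite day_rewardS.
by apply: average_normr_le => //; [exact: mean_trans_ge0|exact: mean_trans_sum1].
Qed.

Variable beta : R.
Hypothesis beta01 : 0 <= beta < 1.

Let discounted_reward k s : R^nat :=
  fun n => beta ^+ n * day_reward f g k n s.

Lemma is_cvg_payoff k s : cvgn (series (discounted_reward k s)).
Proof.
case/andP: beta01 => beta_ge0 beta_lt1.
apply: normed_cvg; apply: (series_le_cvg
    (v_ := geometric (\sum_t `|mean_reward f g k t|) beta)) => [n|n|n|].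
- exact: normr_ge0.
- by rewrite /= mulr_ge0 ?exprn_ge0// sumr_ge0.
- rewrite /= /discounted_reward normrM ger0_norm ?exprn_ge0// mulrC.
  by rewrite ler_wpM2r ?exprn_ge0// day_reward_bounded.
- by apply: is_cvg_geometric_series; rewrite ger0_norm.
Qed.

(** Splitting off day 0 expresses each partial sum of the payoff series by
    the preceding ones; the equation is the limit of these identities. *)
Lemma payoff_recursion k s :
  payoff f g beta k s = mean_reward f g k s +
    beta * \sum_t mean_trans f g s t * payoff f g beta k t.
Proof.
have payoffE t : series (discounted_reward k t) @ \oo --> payoff f g beta k t.
  by rewrite ffunE; exact: is_cvg_payoff.
have seriesS n : series (discounted_reward k s) n.+1 = mean_reward f g k s +
    beta * \sum_t mean_trans f g s t * series (discounted_reward k t) n.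
  rewrite /series/= big_nat_recl//= /discounted_reward expr0 mul1r day_reward0.
  congr (_ + _).
  under [in RHS]eq_bigr do rewrite mulr_sumr.
  rewrite exchange_big/= mulr_sumr; apply: eq_bigr => n' _.
  rewrite day_rewardS !mulr_sumr; apply: eq_bigr => t _.
  by rewrite exprS; ring.
have lhs : (fun n => series (discounted_reward k s) n.+1) @ \oo -->
    payoff f g beta k s by rewrite (cvg_shiftS (series _)).
rewrite (funext seriesS) in lhs.
apply: (cvg_unique _ lhs) => //.
apply: cvgD; first exact: cvg_cst.
apply: cvgM; first exact: cvg_cst.
apply: cvg_big => [|t _]; first exact: add_continuous.
by apply: cvgM; [exact: cvg_cst|exact: payoffE].
Qed.

(** The two players' versions isolate the factor [f] or [g], so that what
    remains is the equation of a one-player decision problem. *)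
Lemma payoff_recursionP1 k s :
  payoff f g beta k s = \sum_i f s i *
    (\sum_j g s j * reward k i j + beta *
     \sum_t (\sum_j g s j * trans i j t) * payoff f g beta k t).
Proof.
rewrite [LHS]payoff_recursion /mean_reward /mean_trans.
under [in RHS]eq_bigr do rewrite mulrDr.
rewrite big_split/=; congr (_ + _).
  apply: eq_bigr => i _; rewrite mulr_sumr.
  by apply: eq_bigr => j _; rewrite mulrA.
under eq_bigr do rewrite mulr_suml.
rewrite exchange_big/= mulr_sumr; apply: eq_bigr => i _.
rewrite mulrCA; congr (_ * _); rewrite mulr_sumr; apply: eq_bigr => t _.
rewrite mulrA; congr (_ * _); rewrite mulr_sumr.
by apply: eq_bigr => j _; rewrite mulrA.
Qed.

Lemma payoff_recursionP2 k s :
  payoff f g beta k s = \sum_j g s j *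
    (\sum_i f s i * reward k i j + beta *
     \sum_t (\sum_i f s i * trans i j t) * payoff f g beta k t).
Proof.
rewrite [LHS]payoff_recursion /mean_reward /mean_trans.
under [in RHS]eq_bigr do rewrite mulrDr.
rewrite big_split/= exchange_big/=; congr (_ + _).
  apply: eq_bigr => j _; rewrite mulr_sumr.
  by apply: eq_bigr => i _; rewrite mulrA [f s i * _]mulrC.
under eq_bigr do rewrite exchange_big/= mulr_suml.
rewrite exchange_big/= mulr_sumr; apply: eq_bigr => j _.
rewrite mulrCA; congr (_ * _); rewrite mulr_sumr; apply: eq_bigr => t _.
rewrite mulrA; congr (_ * _); rewrite mulr_sumr.
by apply: eq_bigr => i _; rewrite mulrA [f s i * _]mulrC.
Qed.

End PayoffRecursion.

(** * Completely mixed optimal strategies *)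

Section PureStrategy.
Variables (R : realType) (G : game R) (k : player).
Variable d : forall s : state G, action G k s.

Definition pure_prob (s : state G) (a : action G k s) : R := (a == d s)%:R.

Lemma pure_prob_ge0 s (a : action G k s) : 0 <= pure_prob a.
Proof. exact: ler0n. Qed.

Lemma pure_average s (x : action G k s -> R) :
  \sum_a pure_prob a * x a = x (d s).
Proof.
rewrite (bigD1 (d s))//= /pure_prob eqxx mul1r big1 ?addr0// => a ad.
by rewrite (negPf ad) mul0r.
Qed.

Lemma pure_prob_sum1 s : \sum_(a : action G k s) pure_prob a = 1.
Proof.
rewrite -[RHS](@pure_average s (fun=> 1)).
by apply: eq_bigr => a _; rewrite mulr1.
Qed.

Definition pure_strategy : strategy G k :=
  Strategy pure_prob_ge0 pure_prob_sum1.

End PureStrategy.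

(** The decision problem of player [k] against a fixed opponent has expected
    rewards [c] and transition probabilities [p]; [V h] is the value of [h]. *)
Section Optimality.
Variables (R : realType) (G : game R) (k : player) (beta : R).
Variables (c : forall s : state G, action G k s -> R)
  (p : forall s : state G, action G k s -> state G -> R).
Variable V : strategy G k -> state G -> R.
Hypotheses (beta01 : 0 <= beta < 1)
  (p_ge0 : forall s (a : action G k s) t, 0 <= p a t)
  (p_sum1 : forall s (a : action G k s), \sum_t p a t = 1)
  (VE : forall h s,
    V h s = \sum_a h s a * (c a + beta * \sum_t p a t * V h t)).

Let Q h s (a : action G k s) : R := c a + beta * \sum_t p a t * V h t.

Let mixed_trans (h : strategy G k) (s t : state G) : R :=
  \sum_a h s a * p a t.

Let mixed_trans_ge0 h s t : 0 <= mixed_trans h s t.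
Proof. by apply: sumr_ge0 => a _; rewrite mulr_ge0 ?prob_ge0. Qed.

Let mixed_trans_sum1 h s : \sum_t mixed_trans h s t = 1.
Proof.
rewrite exchange_big/= -(prob_sum1 h s); apply: eq_bigr => a _.
by rewrite -mulr_sumr p_sum1 mulr1.
Qed.

(** The gain of [h] over [h0] is the gain of using [h] on day 0 only, plus the
    discounted mean of the gain from day 1 on. *)
Let gainE h h0 s :
  V h s - V h0 s = (\sum_a h s a * Q h0 a - V h0 s) +
    beta * \sum_t mixed_trans h s t * (V h t - V h0 t).
Proof.
rewrite {1}VE addrAC; congr (_ - _).
have -> : beta * \sum_t mixed_trans h s t * (V h t - V h0 t) =
    \sum_a h s a * (beta * \sum_t p a t * (V h t - V h0 t)).
  rewrite /mixed_trans; under eq_bigr do rewrite mulr_suml.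
  rewrite exchange_big/= mulr_sumr; apply: eq_bigr => a _.
  rewrite mulrCA; congr (_ * _); rewrite mulr_sumr; apply: eq_bigr => t _.
  by rewrite mulrA.
rewrite -big_split/=; apply: eq_bigr => a _; rewrite -mulrDr; congr (_ * _).
rewrite /Q -addrA -mulrDr; congr (_ + _ * _).
by rewrite -big_split/=; apply: eq_bigr => t _; ring.
Qed.

Variable h0 : strategy G k.
Hypotheses (h0_mixed : completely_mixed h0)
  (h0_optimal : forall h s, V h s <= V h0 s).

(** The competitor is the greedy strategy: its gain over [h0] is nonnegative
    by the minimum principle, hence at least its gain on day 0. *)
Lemma mixed_optimal_bellman s (a : action G k s) :
  c a + beta * \sum_t p a t * V h0 t = V h0 s.
Proof.
case/andP: (beta01) => beta_ge0 _.
have maxP s' : exists d : action G k s',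
    [forall b : action G k s', Q h0 b <= Q h0 d].
  have /card_gt0P[a0 _] := action_nonempty k s'.
  exists [arg max_(b > a0) Q h0 b]%O.
  by apply/forallP => b; case: arg_maxP => // d _; apply.
pose d s' := xchoose (maxP s').
have dP s' (b : action G k s') : Q h0 b <= Q h0 (d s').
  exact: (forallP (xchooseP (maxP s'))).
have h0_avg s' : \sum_b h0 s' b * Q h0 b = V h0 s' by rewrite VE.
have day0_ge0 s' : V h0 s' <= Q h0 (d s').
  by rewrite -h0_avg; apply: average_le => //;
    [exact: prob_ge0|exact: prob_sum1].
pose h := pure_strategy d.
have hE s' : V h s' - V h0 s' = (Q h0 (d s') - V h0 s') +
    beta * \sum_t mixed_trans h s' t * (V h t - V h0 t).
  by rewrite gainE pure_average.
have gain_ge0 s' : 0 <= V h s' - V h0 s'.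
  apply: (discounted_ge0 beta01 (mixed_trans_ge0 h) (mixed_trans_sum1 h)
    (D := fun t => V h t - V h0 t)) => t.
  by rewrite hE lerDr subr_ge0.
have max_le : Q h0 (d s) <= V h0 s.
  rewrite -subr_le0; apply: le_trans (_ : V h s - V h0 s <= 0); last first.
    by rewrite subr_le0.
  rewrite hE lerDl mulr_ge0// sumr_ge0// => t _.
  by rewrite mulr_ge0.
apply: (average_max_cst (prob_ge0 h0 (s := s)) (prob_sum1 h0 s) (x := @Q h0 s))
  => // b.
by apply: le_trans max_le.
Qed.

Lemma mixed_optimal_indifference h s : V h0 s = V h s.
Proof.
apply/esym/eqP; rewrite -subr_eq0; apply/eqP.
apply: (discounted_eq0 beta01 (mixed_trans_ge0 h) (mixed_trans_sum1 h)
  (D := fun t => V h t - V h0 t)) => t.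
rewrite gainE; under eq_bigr do rewrite /Q mixed_optimal_bellman.
by rewrite average_cst ?prob_sum1// subrr add0r.
Qed.

End Optimality.

(** * Equilibria *)

Theorem theorem4p12 (R : realType) (G : game R) (beta : R)
    (beta01 : 0 <= beta < 1)
    (f0 : strategy G P1) (g0 : strategy G P2)
    (f0g0_nash : nash beta f0 g0)
    (f0_mixed : completely_mixed f0) (g0_mixed : completely_mixed g0)
    (f : strategy G P1) (g : strategy G P2) :
  payoff f0 g0 beta P2 = payoff f0 g beta P2 /\
  payoff f0 g0 beta P1 = payoff f g0 beta P1.
Proof.
case: f0g0_nash => f0_best g0_best; split; apply/ffunP => s.
- apply: (mixed_optimal_indifference (V := fun h => payoff f0 h beta P2)
    beta01 _ _ (fun h => payoff_recursionP2 f0 h beta01 P2)) => // s' j.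
    by move=> t; apply: sumr_ge0 => i _; rewrite mulr_ge0 ?prob_ge0 ?trans_ge0.
  rewrite exchange_big/= -(prob_sum1 f0 s'); apply: eq_bigr => i _.
  by rewrite -mulr_sumr trans_sum1 mulr1.
- apply: (mixed_optimal_indifference (V := fun h => payoff h g0 beta P1)
    beta01 _ _ (fun h => payoff_recursionP1 h g0 beta01 P1)) => // s' i.
    by move=> t; apply: sumr_ge0 => j _; rewrite mulr_ge0 ?prob_ge0 ?trans_ge0.
  rewrite exchange_big/= -(prob_sum1 g0 s'); apply: eq_bigr => j _.
  by rewrite -mulr_sumr trans_sum1 mulr1.
Qed.
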